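(* ($\mathsf{ZFC}+\mathsf{GC}$) Let $\mathcal{A}$ be a non-trivial partial combinatory algebra (pca). Then $V^f(\mathcal{A})$ thinks that $\mathrm{WDec}(1)$ cannot be a subset of any set; that is, $V^f(\mathcal{A})\models\neg\exists b\,\forall x\,[x\in\mathrm{WDec}(1)\to x\in b]$.
   Context: $\mathsf{GC}$ (Global Choice) postulates that there is a well-order of $V$. $\mathrm{WDec}(1)$ is the class of weakly decidable subsets of $1=\{0\}$; ''$x\in\mathrm{WDec}(1)$'' is expressed by the formula $x\subseteq 1\land(x=0\lor\neg\neg(x=1))$. Realizability: the pca $\mathcal{A}$ is a set, with application written by juxtaposition, with pairing combinator $\mathbf{p}$ and projections $(e)_0,(e)_1$, and with numerals $\mathbf{0},\mathbf{1}\in\mathcal{A}$; it is non-trivial if it has more than one element. $V(\mathcal{A})=\bigcup_{\alpha\in\mathrm{Ord}}V(\mathcal{A})_\alpha$, where $V(\mathcal{A})_\alpha=\bigcup_{\beta\in\alpha}\mathcal{P}(\mathcal{A}\times V(\mathcal{A})_\beta)$. A name $a\in V(\mathcal{A})$ is functional if for all $\langle e,b\rangle,\langle e,c\rangle\in a$ we have $b=c$. $V^f(\mathcal{A})$ is the class of all functional names $a\in V(\mathcal{A})$. The relation $e\Vdash^f\phi$ ($e\in\mathcal{A}$) is McCarty's realizability relation with quantifiers restricted to $V^f(\mathcal{A})$ (application terms are required to be defined): $e\Vdash^f a\in b$ iff there is $c$ with $\langle(e)_0,c\rangle\in b$ and $(e)_1\Vdash^f a=c$; $e\Vdash^f a=b$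 iff for all $f,d$: $\langle f,d\rangle\in a$ implies $(e)_0f\Vdash^f d\in b$, and $\langle f,d\rangle\in b$ implies $(e)_1f\Vdash^f d\in a$; $e\Vdash^f\phi\land\psi$ iff $(e)_0\Vdash^f\phi$ and $(e)_1\Vdash^f\psi$; $e\Vdash^f\phi\lor\psi$ iff ($(e)_0=\mathbf{0}$ and $(e)_1\Vdash^f\phi$) or ($(e)_0=\mathbf{1}$ and $(e)_1\Vdash^f\psi$); $e\Vdash^f\neg\phi$ iff no $g\in\mathcal{A}$ satisfies $g\Vdash^f\phi$; $e\Vdash^f\phi\to\psi$ iff for all $g\in\mathcal{A}$, $g\Vdash^f\phi$ implies $eg\Vdash^f\psi$; $e\Vdash^f\forall x\in a\,\phi(x)$ iff for all $\langle g,c\rangle\in a$, $eg\Vdash^f\phi(c)$; $e\Vdash^f\exists x\in a\,\phi(x)$ iff there is $c$ with $\langle(e)_0,c\rangle\in a$ and $(e)_1\Vdash^f\phi(c)$; $e\Vdash^f\forall x\,\phi(x)$ iff $e\Vdash^f\phi(c)$ for all $c\in V^f(\mathcal{A})$; $e\Vdash^f\exists x\,\phi(x)$ iff $e\Vdash^f\phi(c)$ for some $c\in V^f(\mathcal{A})$. $V^f(\mathcal{A})\models\phi$ means that some $e\in\mathcal{A}$ satisfies $e\Vdash^f\phi$. *)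

(* Defs.v *)
Set Implicit Arguments.
Unset Strict Implicit.
Unset Printing Implicit Defensive.

(* [V] is the universe of sets and [In] its membership relation.  Classes are
   predicates on [V]; the separation and replacement schemas range over all of
   them. *)

Section Universe.

Variables (V : Type) (In : V -> V -> Prop).

Definition is_empty (x : V) : Prop := forall y, ~ In y x.

Definition subset (x y : V) : Prop := forall z, In z x -> In z y.

Definition is_upair (z x y : V) : Prop := forall w, In w z <-> w = x \/ w = y.

(* Kuratowski: z = {{x}, {x, y}}. *)
Definition is_opair (z x y : V) : Prop :=
  exists s t, is_upair s x x /\ is_upair t x y /\ is_upair z s t.

Definition opair_in (x y a : V) : Prop := exists z, is_opair z x y /\ In z a.

Record ZFC : Prop := {
  extensionality : forall x y, (forall z, In z x <-> In z y) -> x = y;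
  pairing : forall x y, exists z, is_upair z x y;
  union : forall x, exists u, forall z, In z u <-> exists y, In y x /\ In z y;
  powerset : forall x, exists p, forall y, In y p <-> subset y x;
  infinity : exists w,
    (exists o, is_empty o /\ In o w) /\
    (forall n, In n w ->
       exists m, (forall z, In z m <-> In z n \/ z = n) /\ In m w);
  separation : forall (P : V -> Prop) x,
    exists y, forall z, In z y <-> In z x /\ P z;
  replacement : forall (F : V -> V -> Prop) x,
    (forall y, In y x -> exists! z, F y z) ->
    exists u, forall z, In z u <-> exists y, In y x /\ F y z;
  foundation : forall x, (exists y, In y x) ->
    exists y, In y x /\ forall z, In z y -> ~ In z x;
  choice : forall x,
    (forall y, In y x -> exists z, In z y) ->
    (forall y y' z, In y x -> In y' x -> In z y -> In z y' -> y = y') ->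
    exists c, forall y, In y x -> exists! z, In z y /\ In z c
}.

Definition transitive_set (x : V) : Prop :=
  forall y z, In y x -> In z y -> In z x.

Definition ordinal (x : V) : Prop :=
  transitive_set x /\ forall y, In y x -> transitive_set y.

Definition elt (A : V) : Type := { e : V | In e A }.

Definition elt_val (A : V) (e : elt A) : V := proj1_sig e.

End Universe.

Record well_order (V : Type) (lt : V -> V -> Prop) : Prop := {
  wo_irrefl : forall x, ~ lt x x;
  wo_trans : forall x y z, lt x y -> lt y z -> lt x z;
  wo_total : forall x y, lt x y \/ x = y \/ lt y x;
  wo_least : forall P : V -> Prop, (exists x, P x) ->
    exists x, P x /\ forall y, P y -> ~ lt y x
}.

Definition GC (V : Type) : Prop := exists lt : V -> V -> Prop, well_order lt.

(* [None] is the undefined value, so equality of [option T] is Kleene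
   equality. *)
Definition papp (T : Type) (app : T -> T -> option T) (x y : option T)
    : option T :=
  match x, y with
  | Some a, Some b => app a b
  | _, _ => None
  end.

Record pca (T : Type) : Type := {
  app : T -> T -> option T;
  comb_k : T;
  comb_s : T;
  k_law : forall a b, papp app (app comb_k a) (Some b) = Some a;
  s_def : forall a b, papp app (app comb_s a) (Some b) <> None;
  s_law : forall a b c,
    papp app (papp app (app comb_s a) (Some b)) (Some c)
    = papp app (app a c) (app b c)
}.

(* Every pca has such a coding, definable from [comb_k] and [comb_s].  The
   numerals 0 and 1 are constrained only through definition by cases, which
   leaves room for any of the usual encodings and forces them apart unless the
   pca is trivial. *)
Record pca_coding (T : Type) (P : pca T) : Type := {
  pairc : T;
  pr0 : T;
  pr1 : T;
  zero : T;
  one : T;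
  cases : T;
  pair_law : forall a b, exists c,
    papp (app P) (app P pairc a) (Some b) = Some c /\
    app P pr0 c = Some a /\ app P pr1 c = Some b;
  cases_zero : forall a b,
    papp (app P) (papp (app P) (app P cases zero) (Some a)) (Some b) = Some a;
  cases_one : forall a b,
    papp (app P) (papp (app P) (app P cases one) (Some a)) (Some b) = Some b
}.

Definition nontrivial (T : Type) : Prop := exists a b : T, a <> b.

(* Formulas of set theory with parameters in [X]; binders are represented by
   functions on parameters. *)
Inductive form (X : Type) : Type :=
| Mem (x y : X)
| Eq (x y : X)
| And (p q : form X)
| Or (p q : form X)
| Neg (p : form X)
| Imp (p q : form X)
| BAll (a : X) (p : X -> form X)
| BEx (a : X) (p : X -> form X)
| All (p : X -> form X)
| Ex (p : X -> form X).

(* The defined constants 0 and 1 = {0} are eliminated: "y in 1" is "y = 0". *)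
Definition eq0 (X : Type) (x : X) : form X := BAll x (fun y => Neg (Eq y y)).

Definition sub1 (X : Type) (x : X) : form X := BAll x (fun y => eq0 y).

Definition eq1 (X : Type) (x : X) : form X :=
  And (sub1 x) (BEx x (fun y => eq0 y)).

Definition inWDec1 (X : Type) (x : X) : form X :=
  And (sub1 x) (Or (eq0 x) (Neg (Neg (eq1 x)))).

Section Realizability.

Variables (V : Type) (In : V -> V -> Prop) (A : V).

(* [in_VA alpha a]: a is in V(A)_alpha, the union over beta in alpha of
   P(A x V(A)_beta). *)
Inductive in_VA : V -> V -> Prop :=
| in_VA_intro (alpha beta a : V) :
    In beta alpha ->
    (forall z, In z a -> exists (e : elt In A) (b : V),
       is_opair In z (elt_val e) b /\ in_VA beta b) ->
    in_VA alpha a.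

Definition name (a : V) : Prop := exists alpha, ordinal In alpha /\ in_VA alpha a.

Definition functional (a : V) : Prop :=
  forall (e : elt In A) (b c : V),
    opair_in In (elt_val e) b a -> opair_in In (elt_val e) c a -> b = c.

Definition Vf (a : V) : Prop := name a /\ functional a.

Variables (P : pca (elt In A)) (C : pca_coding P).

(* Realizability of atomic formulas is defined by recursion on names.  Its
   clauses are monotone, so they can be read as an inductive definition; by
   foundation the least solution is the only one. *)
Inductive rz_mem : elt In A -> V -> V -> Prop :=
| rz_mem_intro (e e0 e1 : elt In A) (a b c : V) :
    app P (pr0 C) e = Some e0 -> app P (pr1 C) e = Some e1 ->
    opair_in In (elt_val e0) c b -> rz_eq e1 a c ->
    rz_mem e a b
with rz_eq : elt In A -> V -> V -> Prop :=
| rz_eq_intro (e : elt In A) (a b : V) :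
    (forall (f : elt In A) d, opair_in In (elt_val f) d a ->
       exists u, papp (app P) (app P (pr0 C) e) (Some f) = Some u /\
                 rz_mem u d b) ->
    (forall (f : elt In A) d, opair_in In (elt_val f) d b ->
       exists u, papp (app P) (app P (pr1 C) e) (Some f) = Some u /\
                 rz_mem u d a) ->
    rz_eq e a b.

Fixpoint realizes (e : elt In A) (phi : form V) {struct phi} : Prop :=
  match phi with
  | Mem a b => rz_mem e a b
  | Eq a b => rz_eq e a b
  | And p q =>
      (exists u, app P (pr0 C) e = Some u /\ realizes u p) /\
      (exists u, app P (pr1 C) e = Some u /\ realizes u q)
  | Or p q =>
      (app P (pr0 C) e = Some (zero C) /\
       exists u, app P (pr1 C) e = Some u /\ realizes u p) \/
      (app P (pr0 C) e = Some (one C) /\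
       exists u, app P (pr1 C) e = Some u /\ realizes u q)
  | Neg p => forall g, ~ realizes g p
  | Imp p q => forall g, realizes g p ->
      exists u, app P e g = Some u /\ realizes u q
  | BAll a p => forall (g : elt In A) c, opair_in In (elt_val g) c a ->
      exists u, app P e g = Some u /\ realizes u (p c)
  | BEx a p => exists (g : elt In A) c,
      app P (pr0 C) e = Some g /\ opair_in In (elt_val g) c a /\
      exists u, app P (pr1 C) e = Some u /\ realizes u (p c)
  | All p => forall c, Vf c -> realizes e (p c)
  | Ex p => exists c, Vf c /\ realizes e (p c)
  end.

Definition Vf_models (phi : form V) : Prop := exists e, realizes e phi.

End Realizability.

(* Main.v *)
Require Import Defs.
From Stdlib Require Import ProofIrrelevance.

(** For [a] in the pca let [x_a] be the name whose only element is the pair of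
    [a] and the empty name.  Its element carries the empty name, so [x_a] is
    realized to be a subset of 1, and it is in fact realized to be equal to 1;
    but the realizer of this equality has to produce [a].  The double negation
    in the definition of WDec(1) hides that information: a single [w], the same
    for all [a], realizes that [x_a] is weakly decidable
    ([weakly_decidable_uniformly]).

    Suppose that [e] realizes that every weakly decidable subset of 1 belongs to
    a functional name [b].  The realizer [e w] selects by its first component a
    member [c] of [b], and there is only one such [c] because [b] is functional.
    Its second component therefore realizes [x_a = c] for every [a]. Following
    this equality from some fixed [x_d] to [c] gives an index [v] of a member of
    [c], and following it from [c] back to [x_a] turns [v] into [a]. The second
    step does not see [a] either, so any two elements [a] coincide
    ([common_equal_trivial]) and the pca is trivial. *)

Section SetTheory.

Variables (V : Type) (In : V -> V -> Prop) (HZFC : ZFC In).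

Lemma exists_empty : exists o, is_empty In o.
Proof.
  destruct (infinity HZFC) as (w & (o & Ho & _) & _).
  exists o; exact Ho.
Qed.

Lemma opair_inj (z x y x' y' : V) :
  is_opair In z x y -> is_opair In z x' y' -> x = x' /\ y = y'.
Proof.
  intros (s & t & Hs & Ht & Hz) (s' & t' & Hs' & Ht' & Hz').
  assert (Ex : x' = x).
  { assert (Hx' : In x' s).
    { destruct (proj1 (Hz' s) (proj2 (Hz s) (or_introl eq_refl))) as [-> | ->].
      - apply Hs'; left; reflexivity.
      - apply Ht'; left; reflexivity. }
    destruct (proj1 (Hs x') Hx') as [E | E]; exact E. }
  subst x'; split; [reflexivity |].
  assert (Ey : y = x \/ y = y').
  { assert (Hy : In y t) by (apply Ht; right; reflexivity).
    destruct (proj1 (Hz' t) (proj2 (Hz t) (or_intror eq_refl))) as [-> | ->].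
    - left; destruct (proj1 (Hs' y) Hy) as [E | E]; exact E.
    - exact (proj1 (Ht' y) Hy). }
  assert (Ey' : y' = x \/ y' = y).
  { assert (Hy' : In y' t') by (apply Ht'; right; reflexivity).
    destruct (proj1 (Hz t') (proj2 (Hz' t') (or_intror eq_refl))) as [-> | ->].
    - left; destruct (proj1 (Hs y') Hy') as [E | E]; exact E.
    - exact (proj1 (Ht y') Hy'). }
  destruct Ey as [E | E]; [| exact E].
  destruct Ey' as [E' | E']; congruence.
Qed.

Lemma opair_exists (x y : V) : exists z, is_opair In z x y.
Proof.
  destruct (pairing HZFC x x) as [s Hs].
  destruct (pairing HZFC x y) as [t Ht].
  destruct (pairing HZFC s t) as [z Hz].
  exists z, s, t; auto.
Qed.

(** The ordinals 1 and 2, which bound the ranks of the empty name and of the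
    names [x_a]. *)
Lemma ordinals_one_two (o : V) : is_empty In o ->
  exists i k, In o i /\ In i k /\ ordinal In i /\ ordinal In k.
Proof.
  intros Ho.
  destruct (pairing HZFC o o) as [i Hi].
  destruct (pairing HZFC o i) as [k Hk].
  assert (To : transitive_set In o).
  { intros y z Hy; destruct (Ho y Hy). }
  assert (Ti : transitive_set In i).
  { intros y z Hy Hz; apply Hi in Hy.
    destruct Hy as [-> | ->]; destruct (Ho z Hz). }
  exists i, k; split; [apply Hi; auto | split; [apply Hk; auto | split; split]].
  - exact Ti.
  - intros y Hy; apply Hi in Hy; destruct Hy as [-> | ->]; exact To.
  - intros y z Hy Hz; apply Hk in Hy; destruct Hy as [-> | ->].
    + destruct (Ho z Hz).
    + apply Hi in Hz; apply Hk; left; destruct Hz; assumption.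
  - intros y Hy; apply Hk in Hy; destruct Hy as [-> | ->]; assumption.
Qed.

Definition single_name (A : V) (a : elt In A) (d x : V) : Prop :=
  exists p, is_opair In p (elt_val a) d /\ is_upair In x p p.

Lemma single_name_exists (A : V) (a : elt In A) (d : V) :
  exists x, single_name A a d x.
Proof.
  destruct (opair_exists (elt_val a) d) as [p Hp].
  destruct (pairing HZFC p p) as [x Hx].
  exists x, p; auto.
Qed.

Lemma single_name_self (A : V) (a : elt In A) (d x : V) :
  single_name A a d x -> opair_in In (elt_val a) d x.
Proof.
  intros (p & Hp & Hx); exists p; split; [exact Hp | apply Hx; auto].
Qed.

Lemma single_name_inv (A : V) (a f : elt In A) (d c x : V) :
  single_name A a d x -> opair_in In (elt_val f) c x -> f = a /\ c = d.
Proof.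
  intros (p & Hp & Hx) (z & Hz & Hzx).
  assert (E : z = p) by (apply Hx in Hzx; destruct Hzx; assumption).
  subst z; destruct (opair_inj _ _ _ _ _ Hz Hp) as [Ef Ec].
  split; [apply eq_sig_hprop; [intros; apply proof_irrelevance | exact Ef]
         | exact Ec].
Qed.

Lemma single_name_Vf (A : V) (a : elt In A) (o x : V) :
  is_empty In o -> single_name A a o x -> Vf In A x.
Proof.
  intros Ho Hx; split.
  - destruct (ordinals_one_two o Ho) as (i & k & Hoi & Hik & _ & Hk).
    exists k; split; [exact Hk |].
    apply (in_VA_intro Hik).
    destruct Hx as (p & Hp & Hx).
    intros z Hz; exists a, o; split.
    + apply Hx in Hz; destruct Hz as [-> | ->]; exact Hp.
    + apply (in_VA_intro Hoi); intros y Hy; destruct (Ho y Hy).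
  - intros f b c Hb Hc.
    destruct (single_name_inv _ _ _ _ _ _ Hx Hb) as [_ ->].
    destruct (single_name_inv _ _ _ _ _ _ Hx Hc) as [_ ->].
    reflexivity.
Qed.

Section Realizers.

Variables (A : V) (P : pca (elt In A)) (C : pca_coding P).

Lemma pair_exists (a b : elt In A) :
  exists c, app P (pr0 C) c = Some a /\ app P (pr1 C) c = Some b.
Proof.
  destruct (pair_law C a b) as (c & _ & H); exists c; exact H.
Qed.

Lemma const_exists (a : elt In A) :
  exists c, forall g, app P c g = Some a.
Proof.
  destruct (app P (comb_k P) a) as [c |] eqn:E.
  - exists c; intros g; generalize (k_law P a g); rewrite E; exact (fun H => H).
  - generalize (k_law P a a); rewrite E; discriminate.
Qed.

Lemma realizes_eq0 (e : elt In A) (o : V) :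
  is_empty In o -> realizes C e (eq0 o).
Proof.
  intros Ho g c (z & _ & Hz); destruct (Ho z Hz).
Qed.

Lemma realizes_sub1 (s t a : elt In A) (o x : V) :
  (forall g, app P s g = Some t) ->
  is_empty In o -> single_name A a o x -> realizes C s (sub1 x).
Proof.
  intros Hs Ho Hx g c Hc.
  destruct (single_name_inv _ _ _ _ _ _ Hx Hc) as [_ ->].
  exists t; split; [apply Hs | apply realizes_eq0; exact Ho].
Qed.

(** The order of the quantifiers is the point: [w] is chosen before [a].  A
    realizer of [eq1 x] depends on [a], but the double negation asks only for
    its existence. *)
Lemma weakly_decidable_uniformly (o : V) : is_empty In o ->
  exists w, forall a x, single_name A a o x -> realizes C w (inWDec1 x).
Proof.
  intros Ho.
  destruct (const_exists (zero C)) as [s Hs].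
  destruct (pair_exists (one C) s) as (r & Hr0 & Hr1).
  destruct (pair_exists s r) as (w & Hw0 & Hw1).
  exists w; intros a x Hx; split.
  - exists s; split; [exact Hw0 |].
    exact (realizes_sub1 _ _ _ _ _ Hs Ho Hx).
  - exists r; split; [exact Hw1 |].
    right; split; [exact Hr0 |].
    exists s; split; [exact Hr1 |].
    intros g Hg.
    destruct (pair_exists a s) as (v & Hv0 & Hv1).
    destruct (pair_exists s v) as (q & Hq0 & Hq1).
    apply (Hg q); split.
    + exists s; split; [exact Hq0 |].
      exact (realizes_sub1 _ _ _ _ _ Hs Ho Hx).
    + exists v; split; [exact Hq1 |].
      exists a, o; split; [exact Hv0 |].
      split; [exact (single_name_self _ _ _ _ Hx) |].
      exists s; split; [exact Hv1 | apply realizes_eq0; exact Ho].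
Qed.

(** The realizer of a membership in the one-element name [y] has the index of
    that element as its first component. *)
Lemma rz_mem_single (e a : elt In A) (c d y : V) :
  single_name A a d y -> rz_mem C e c y -> app P (pr0 C) e = Some a.
Proof.
  intros Hy H; destruct H as [e e0 e1 c' y c0 He0 _ Hin _].
  destruct (single_name_inv _ _ _ _ _ _ Hy Hin) as [<- _]; exact He0.
Qed.

(** The first half of [e], applied to [a], produces an index [v] of a member of
    [c], and the second half of [e], applied to [v], produces the index of a
    member of [x] as well as of [y]. *)
Lemma common_equal_trivial (e a b : elt In A) (d d' x y c : V) :
  single_name A a d x -> single_name A b d' y ->
  rz_eq C e x c -> rz_eq C e y c -> a = b.
Proof.
  intros Hx Hy Ex Ey.
  destruct Ex as [e x c Exc Ecx]; inversion Ey as [e' y' c' _ Ecy]; subst.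
  destruct (Exc a d (single_name_self _ _ _ _ Hx)) as (u & _ & Hu).
  destruct Hu as [u v u1 d0 c m _ _ Hv _].
  destruct (Ecx v m Hv) as (r & Hr & Hrx).
  destruct (Ecy v m Hv) as (r' & Hr' & Hry).
  assert (E : r' = r) by congruence; subst r'.
  apply (rz_mem_single _ _ _ _ _ Hx) in Hrx.
  apply (rz_mem_single _ _ _ _ _ Hy) in Hry.
  congruence.
Qed.

(** Functionality of [b] is what makes the first component of [e] determine the
    member of [b] that is realized to be equal to [x]. *)
Lemma rz_mem_functional (e : elt In A) (x y b : V) :
  functional In A b -> rz_mem C e x b -> rz_mem C e y b ->
  exists r c, rz_eq C r x c /\ rz_eq C r y c.
Proof.
  intros Hb Hx Hy.
  destruct Hx as [e e0 e1 x b c He0 He1 Hc Hxc].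
  inversion Hy as [e' f0 f1 y' b' c' Hf0 Hf1 Hc' Hyc']; subst.
  assert (E0 : f0 = e0) by congruence; subst f0.
  assert (E1 : f1 = e1) by congruence; subst f1.
  assert (E : c' = c) by exact (Hb e0 c' c Hc' Hc); subst c'.
  exists e1, c; auto.
Qed.

End Realizers.

End SetTheory.

Theorem proposition8p4 (V : Type) (In : V -> V -> Prop)
    (HZFC : ZFC In) (HGC : GC V)
    (A : V) (P : pca (elt In A)) (C : pca_coding P)
    (HA : nontrivial (elt In A)) :
  Vf_models C
    (Neg (Ex (fun b => All (fun x => Imp (inWDec1 x) (Mem x b))))).
Proof.
  (* A negation is realized by every element or by none, so [comb_k P] is an
     arbitrary choice. *)
  exists (comb_k P); intros e (b & (_ & Hfun) & He).
  destruct (exists_empty _ _ HZFC) as [o Ho].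
  destruct (weakly_decidable_uniformly _ _ _ _ C o Ho) as [w Hw].
  destruct HA as (a1 & a2 & Hne); apply Hne.
  destruct (single_name_exists _ _ HZFC A a1 o) as [x1 H1].
  destruct (single_name_exists _ _ HZFC A a2 o) as [x2 H2].
  destruct (He x1 (single_name_Vf _ _ HZFC _ _ _ _ Ho H1) w (Hw _ _ H1))
    as (u & Hu & Hm1).
  destruct (He x2 (single_name_Vf _ _ HZFC _ _ _ _ Ho H2) w (Hw _ _ H2))
    as (u' & Hu' & Hm2).
  assert (E : u' = u) by congruence; subst u'.
  destruct (rz_mem_functional _ _ _ _ C _ _ _ _ Hfun Hm1 Hm2)
    as (r & c & Hr1 & Hr2).
  exact (common_equal_trivial _ _ _ _ C _ _ _ _ _ _ _ _ H1 H2 Hr1 Hr2).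
Qed.
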